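(* Let $(V,g)$ be a Euclidean real vector space of odd dimension $n=2k+1\ge 3$ and let $R$ be a symmetric $(2,2)$ double form on $V$ satisfying the first Bianchi identity. Then $$N_{n-1}(R):=\frac{\mathrm c^{n-3}R^k}{(n-3)!}-\frac{\mathrm c^{n-2}R^k}{(n-2)!}\,g+\frac{\mathrm c^{n-1}R^k}{2\,(n-1)!}\,g^2=0.$$
   Context: Let $(V,g)$ be a Euclidean real vector space of dimension $n$. A $(p,q)$ double form is an element of $\mathcal D^{p,q}=\Lambda^pV^*\otimes\Lambda^qV^*$, identified with a bilinear form $\Lambda^pV\times\Lambda^qV\to\mathbb R$. Exterior product: $(\theta_1\otimes\theta_2)(\theta_3\otimes\theta_4)=(\theta_1\wedge\theta_3)\otimes(\theta_2\wedge\theta_4)$, extended bilinearly; all products and powers in the claim are exterior products; $g$ is regarded as a $(1,1)$ double form. Contraction $\mathrm c:\mathcal D^{p,q}\to\mathcal D^{p-1,q-1}$: $\mathrm c\,\omega(x_1\wedge\dots\wedge x_{p-1},y_1\wedge\dots\wedge y_{q-1})=\sum_{j=1}^n\omega(e_j\wedge x_1\wedge\dots\wedge x_{p-1},e_j\wedge y_1\wedge\dots\wedge y_{q-1})$ for any orthonormal basis $(e_j)$ of $V$; $\mathrm c^j$ is the $j$-fold iterate ($\mathrm c^0$ is the identity), and a $(0,0)$ double form is a scalar. A $(2,2)$ double form $R$ is symmetric if $R(u,v)=R(v,u)$ for $u,v\in\Lambda^2V$, and satisfies the first Bianchi identity if $\sum_{j=1}^{3}(-1)^jR(x_1\wedge\dots\widehat{x_j}\dots\wedge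 x_3,\;x_j\wedge y)=0$ for all $x_1,x_2,x_3,y\in V$. *)

(* Defs.v *)
From HB Require Import structures.
From mathcomp Require Import all_boot all_order all_algebra.
From mathcomp Require Import boolp functions reals.

Set Implicit Arguments.
Unset Strict Implicit.
Unset Printing Implicit Defensive.

Import Order.TTheory GRing.Theory Num.Theory.
Local Open Scope ring_scope.

(* An element w of the bigraded algebra of double forms on V is encoded by    *)
(* its values on lists of vectors: w xs ys is the value of the                *)
(* (size xs, size ys)-component of w at                                       *)
(*   (x_1 /\ ... /\ x_p, y_1 /\ ... /\ y_q)                                   *)
(* for xs = [:: x_1; ...; x_p] and ys = [:: y_1; ...; y_q].  Elements of      *)
(* D^{p,q} are singled out by is_double_form p q; a (0,0) double form is the  *)
(* scalar it takes as value at [::] [::].                                     *)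
Definition mform (R : nzRingType) (V : lmodType R) : Type := seq V -> R.
Definition dform (R : nzRingType) (V : lmodType R) : Type :=
  seq V -> seq V -> R.

(* The pointwise module structure, R acting on itself by multiplication.      *)
HB.instance Definition _ (R : nzRingType) (V : lmodType R) :=
  GRing.Lmodule.copy (dform V) (seq V -> seq V -> R^o).

Section DoubleForms.
Variables (R : comNzRingType) (V : lmodType R).
Implicit Types (a b : mform V) (w : dform V) (xs ys : seq V) (p q k : nat).

(* Off-degree values being zero, the linearity and alternation conditions     *)
(* only have content for lists of size p.                                     *)
Definition is_form p a : Prop :=
  [/\ forall xs, size xs != p -> a xs = 0,
      forall (s1 s2 : seq V) (c : R) (u v : V),
        a (s1 ++ (c *: u + v) :: s2) = c * a (s1 ++ u :: s2) + a (s1 ++ v :: s2)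
    & forall (s1 s2 s3 : seq V) (u : V), a (s1 ++ u :: s2 ++ u :: s3) = 0].

Definition is_double_form p q w : Prop :=
  (forall ys, is_form p (w^~ ys)) /\ (forall xs, is_form q (w xs)).

(* A mask m on the positions of a list x_1, ..., x_N selects a sublist and,   *)
(* with the complementary sublist, describes a shuffle; its signature is that *)
(* of the permutation listing the selected positions first, both in           *)
(* increasing order, whose inversions are counted here.                       *)
Definition shuffle_sign (N : nat) (m : N.-tuple bool) : R :=
  (-1) ^+ (\sum_(i < N) \sum_(j < N) [&& (i < j)%N, ~~ tnth m i & tnth m j]).

(* Exterior product of V^*, with the normalisation                            *)
(*   (f_1 /\ ... /\ f_p) (x_1, ..., x_p) = det (f_i x_j)                      *)
(* which identifies the p-th exterior power of V^* with the dual of that of V *)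
(* (see wedge_det2 for p = 2).                                                *)
Definition wedge a b : mform V := fun xs =>
  \sum_(m : (size xs).-tuple bool)
     shuffle_sign m * (a (mask m xs) * b (mask (map negb m) xs)).

Definition dtens a b : dform V := fun xs ys => a xs * b ys.

Definition dmul (w1 w2 : dform V) : dform V := fun xs ys =>
  \sum_(m1 : (size xs).-tuple bool) \sum_(m2 : (size ys).-tuple bool)
     shuffle_sign m1 * shuffle_sign m2 *
     (w1 (mask m1 xs) (mask m2 ys) *
      w2 (mask (map negb m1) xs) (mask (map negb m2) ys)).

Definition dunit : dform V := fun xs ys => (nilp xs && nilp ys)%:R.

Definition dexp w k : dform V := iter k (dmul w) dunit.

Definition contr (n : nat) (e : n.-tuple V) w : dform V := fun xs ys =>
  \sum_(j < n) w (tnth e j :: xs) (tnth e j :: ys).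

Definition contrn (n : nat) (e : n.-tuple V) k w : dform V :=
  iter k (contr e) w.

Definition dsymmetric w : Prop := forall xs ys, w xs ys = w ys xs.

Definition bianchi1 w : Prop := forall (x : 'I_3 -> V) (y : V),
  \sum_(j < 3)
    (-1) ^+ j.+1 * w [seq x i | i <- enum 'I_3 & i != j] [:: x j; y] = 0.

Definition dform11 (g : V -> V -> R) : dform V := fun xs ys =>
  if (xs, ys) is ([:: x], [:: y]) then g x y else 0.

(* The defining property of the product of double forms; by construction dmul *)
(* is bilinear.                                                               *)
Lemma dmul_dtens a1 b1 a2 b2 :
  dmul (dtens a1 b1) (dtens a2 b2) = dtens (wedge a1 a2) (wedge b1 b2).
Proof.
apply/funext => xs; apply/funext => ys.
rewrite /dmul /dtens /wedge mulr_suml; apply: eq_bigr => m1 _.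
rewrite mulr_sumr; apply: eq_bigr => m2 _.
by rewrite [RHS]mulrACA; congr (_ * _); rewrite mulrACA.
Qed.

Definition form1 (f : V -> R) : mform V := fun xs =>
  if xs is [:: x] then f x else 0.

Lemma sum_tuple_cons (N : nat) (F : N.+1.-tuple bool -> R) :
  \sum_m F m =
  \sum_(m : N.-tuple bool) (F [tuple of true :: m] + F [tuple of false :: m]).
Proof.
rewrite (reindex (fun bm : bool * N.-tuple bool => [tuple of bm.1 :: bm.2])) /=.
  rewrite -(pair_bigA _ (fun (c : bool) (m : N.-tuple bool) =>
                           F [tuple of c :: m])) /=.
  by rewrite big_bool /= -big_split.
exists (fun m : N.+1.-tuple bool => (thead m, [tuple of behead m])) => /= m _.
  by case: m => c m /=; rewrite theadE; congr pair; apply/val_inj.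
by rewrite -tuple_eta.
Qed.

Lemma wedge_det2 (f h : V -> R) (x y : V) :
  wedge (form1 f) (form1 h) [:: x; y] = f x * h y - f y * h x.
Proof.
rewrite /wedge !sum_tuple_cons (big_pred1 [tuple]) => [|m]; last first.
  by rewrite [m]tuple0; apply/esym/eqP/val_inj.
rewrite /shuffle_sign !big_ord_recl !big_ord0 /=.
rewrite !(mulr0, addr0, add0r, addn0, add0n) expr0 expr1 mul1r mulN1r.
by rewrite addrC.
Qed.

End DoubleForms.

Definition orthonormal_basis (R : realType) (V : vectType R)
    (g : {dot V for idfun}) (n : nat) (e : n.-tuple V) : Prop :=
  basis_of fullv e /\ orthonormal g e.

(* Main.v *)
(* If w is a (p,p) double form in dimension n, then
     c (w g) = (c w) g + (n - 2p) w,
   by the Leibniz rule for interior products and Euler's identity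
   sum_j i_(e_j) a /\ e_j^* = +- p a.  Iterating,
     c^(m+1) (w g) = (c^(m+1) w) g + (m+1) (n - 2p + m) c^m w.
   For w = R^k, of bidegree (n-1,n-1), the product (w g) g vanishes for degree
   reasons; expanding c^(n-1) ((w g) g) = 0 with this formula gives
     (c^(n-1) w) g^2 - 2(n-1) (c^(n-2) w) g + 2(n-1)(n-2) c^(n-3) w = 0,
   which is 2 (n-1)! times the claim. *)
Require Import Defs.
From mathcomp Require Import all_boot all_order all_algebra.
From mathcomp Require Import boolp functions reals.
From mathcomp Require Import ring.

Import GRing.Theory Num.Theory.
Local Open Scope ring_scope.

(** * Alternating forms and interior products *)

Section Forms.
Set Implicit Arguments.
Unset Strict Implicit.

Variables (R : comNzRingType) (V : lmodType R).
Implicit Types (a b : mform V) (x y u v : V) (xs ys : seq V) (c : R) (p q : nat).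

Definition iprod x a : mform V := fun xs => a (x :: xs).

(* is_form p, restated by recursion on p through interior products, so that
   facts about wedge products follow from the Leibniz rule by induction. *)
Fixpoint alt p a : Prop :=
  if p is p'.+1 then
    [/\ a [::] = 0,
        forall c u v xs,
          a (c *: u + v :: xs) = c * a (u :: xs) + a (v :: xs),
        forall u xs, a [:: u, u & xs] = 0
      & forall u, alt p' (iprod u a)]
  else forall x xs, a (x :: xs) = 0.

Lemma is_form_alt p a : is_form p a -> alt p a.
Proof.
elim: p a => [|p IHp] a [szP linP altP] /=; first by move=> x xs; apply: szP.
split; first exact: szP.
- by move=> c u v xs; have := linP [::] xs c u v.
- by move=> u xs; have := altP [::] [::] xs u.
move=> u; apply: IHp; split=> [xs szxs | s1 s2 c v w | s1 s2 s3 v].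
- exact: szP.
- by have := linP (u :: s1) s2 c v w.
- by have := altP (u :: s1) s2 s3 v.
Qed.

Lemma alt_size p a xs : alt p a -> size xs != p -> a xs = 0.
Proof.
elim: p a xs => [|p IHp] a [|x xs] //=.
- by case.
by case=> _ _ _ aP szxs; apply: (IHp (iprod x a)).
Qed.

Lemma alt0 p : alt p (fun=> 0).
Proof. by elim: p => [|p IHp] //=; split=> // *; rewrite mulr0 addr0. Qed.

Lemma alt_lin p a b c : alt p a -> alt p b -> alt p (fun xs => c * a xs + b xs).
Proof.
elim: p a b => [|p IHp] a b /=.
  by move=> aP bP x xs; rewrite aP bP mulr0 addr0.
move=> [a0 aL aA aI] [b0 bL bA bI]; split.
- by rewrite a0 b0 mulr0 addr0.
- by move=> d u v xs; rewrite aL bL; ring.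
- by move=> u xs; rewrite aA bA mulr0 addr0.
- by move=> u; exact: (IHp (iprod u a) (iprod u b)).
Qed.

Lemma alt_scale p a c : alt p a -> alt p (fun xs => c * a xs).
Proof.
move=> aP; have := alt_lin c aP (alt0 p).
by congr alt; apply/funext => xs; rewrite addr0.
Qed.

Lemma alt_sum p (I : Type) (r : seq I) (F : I -> mform V) :
  (forall i, alt p (F i)) -> alt p (fun xs => \sum_(i <- r) F i xs).
Proof.
move=> FP; elim: r => [|i r IHr].
  by have := alt0 p; congr alt; apply/funext => xs; rewrite big_nil.
have := alt_lin 1 (FP i) IHr.
by congr alt; apply/funext => xs; rewrite big_cons mul1r.
Qed.

Lemma alt_swap p a u v xs : alt p a -> a [:: u, v & xs] = - a [:: v, u & xs].
Proof.
case: p => [|p] /=; first by move=> aP; rewrite !aP oppr0.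
case=> a0 aL aA aI; case: p aI => [|p] aI.
  by have /= := aI u => /(_ v xs); have /= := aI v => /(_ u xs);
    rewrite /iprod => -> ->; rewrite oppr0.
have [_ uL uA _] := aI u; have [_ vL vA _] := aI v.
(* Polarisation: expand the vanishing value at the repeated vector [u + v], written [1 *: u + v] to
   match the linearity clause; the terms with [u] or [v] repeated drop out. *)
have := aA (1 *: u + v) xs; rewrite aL mul1r.
have [_ sL _ _] := aI (1 *: u + v).
rewrite -[a (u :: _)]/(iprod u a (1 *: u + v :: xs)) uL mul1r.
rewrite -[a (v :: _)]/(iprod v a (1 *: u + v :: xs)) vL mul1r /iprod !aA.
by rewrite add0r addr0 => /eqP; rewrite addr_eq0 => /eqP.
Qed.

Lemma alt_suml p a n (d : 'I_n -> R) (e : 'I_n -> V) xs : alt p.+1 a ->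
  a (\sum_j d j *: e j :: xs) = \sum_j d j * a (e j :: xs).
Proof.
case=> a0 aL _ _.
have aL0 : a (0 :: xs) = 0.
  (* The combination (-1) 0 + 0 gives a(0) = - a(0) + a(0) = 0. *)
  have := aL (-1) 0 0 xs.
  by rewrite scaler0 add0r mulN1r addNr.
elim: (index_enum _) => [|j r IHr]; first by rewrite !big_nil.
by rewrite !big_cons aL IHr.
Qed.

(** * Leibniz rule for the exterior product *)

Lemma wedge_nil a b : wedge a b [::] = a [::] * b [::].
Proof.
rewrite /wedge (big_pred1 [tuple]) => [|m]; last first.
  by rewrite [m]tuple0; apply/esym/eqP/val_inj.
by rewrite /shuffle_sign !big_ord0 expr0 mul1r.
Qed.

Lemma shuffle_sign_true N (m : N.-tuple bool) :
  shuffle_sign R [tuple of true :: m] = shuffle_sign R m.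
Proof.
rewrite /shuffle_sign big_ord_recl [X in (X + _)%N]big1 ?add0n => [|j _].
  congr (_ ^+ _); apply: eq_bigr => i _; rewrite big_ord_recl add0n.
  by apply: eq_bigr => j _; rewrite !tnthS.
by rewrite !(tnth_nth false) /= andbF.
Qed.

(** An unselected head is inverted with each later selected position, and there are [count id m] of
    these. *)
Lemma shuffle_sign_false N (m : N.-tuple bool) :
  shuffle_sign R [tuple of false :: m]
  = (-1) ^+ (count id m) * shuffle_sign R m.
Proof.
rewrite /shuffle_sign big_ord_recl exprD; congr (_ ^+ _ * _ ^+ _).
  rewrite big_ord_recl /= add0n -sum1_count big_tuple [RHS]big_mkcond /=.
  by apply: eq_bigr => i _; rewrite tnthS; case: (tnth m i).
apply: eq_bigr => i _; rewrite big_ord_recl add0n.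
by apply: eq_bigr => j _; rewrite !tnthS.
Qed.

(** The Leibniz rule: shuffles are split according to whether [x] goes to [a] or to [b]. *)
Lemma wedge_cons p a b x xs : alt p a ->
  wedge a b (x :: xs)
  = wedge (iprod x a) b xs + (-1) ^+ p * wedge a (iprod x b) xs.
Proof.
move=> aP; rewrite /wedge sum_tuple_cons big_split /= mulr_sumr.
congr (_ + _); apply: eq_bigr => m _; first by rewrite shuffle_sign_true.
rewrite shuffle_sign_false /= /iprod -!mulrA.
(* The sign is -1 to the number of selected positions; where this number is not [p], the value of
   [a] is zero and the sign does not matter. *)
have [<-|] := eqVneq (size (mask m xs)) p.
  by rewrite size_mask ?size_tuple.
by move=> szP; rewrite (alt_size aP szP) !(mul0r, mulr0).
Qed.

Lemma wedge0l b : wedge (fun=> 0) b = fun=> 0.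
Proof.
by apply/funext => xs; rewrite /wedge big1 // => m _; rewrite mul0r mulr0.
Qed.

Lemma wedge0r a : wedge a (fun=> 0) = fun=> 0.
Proof. by apply/funext => xs; rewrite /wedge big1 // => m _; rewrite !mulr0. Qed.

Lemma wedge_linl a1 a2 b c xs :
  wedge (fun xs => c * a1 xs + a2 xs) b xs = c * wedge a1 b xs + wedge a2 b xs.
Proof.
by rewrite /wedge mulr_sumr -big_split; apply: eq_bigr => m _ /=; ring.
Qed.

Lemma wedge_linr a b1 b2 c xs :
  wedge a (fun xs => c * b1 xs + b2 xs) xs = c * wedge a b1 xs + wedge a b2 xs.
Proof.
by rewrite /wedge mulr_sumr -big_split; apply: eq_bigr => m _ /=; ring.
Qed.

Lemma wedge_scalel a b c xs :
  wedge (fun xs => c * a xs) b xs = c * wedge a b xs.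
Proof. by rewrite /wedge mulr_sumr; apply: eq_bigr => m _ /=; ring. Qed.

Lemma wedge_scaler a b c xs :
  wedge a (fun xs => c * b xs) xs = c * wedge a b xs.
Proof. by rewrite /wedge mulr_sumr; apply: eq_bigr => m _ /=; ring. Qed.

Lemma iprod_alt0 a x : alt 0 a -> iprod x a = fun=> 0.
Proof. by move=> aP; apply/funext => xs; apply: aP. Qed.

Lemma iprod_alt p a x : alt p.+1 a -> alt p (iprod x a).
Proof. by case=> _ _ _; apply. Qed.

Lemma iprod_lin p a c u v : alt p a ->
  iprod (c *: u + v) a = fun xs => c * iprod u a xs + iprod v a xs.
Proof.
case: p => [aP | p [_ aL _ _]]; apply/funext => xs; last exact: aL.
by rewrite !(iprod_alt0 _ aP) mulr0 addr0.
Qed.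

Lemma iprodxx p a u : alt p a -> iprod u (iprod u a) = fun=> 0.
Proof.
case: p => [aP | p [_ _ aA _]]; apply/funext => xs; last exact: aA.
by rewrite (iprod_alt0 _ aP).
Qed.

Lemma wedge_scalar a b xs : alt 0 a -> wedge a b xs = a [::] * b xs.
Proof.
move=> a0; elim: xs b => [|x xs IHxs] b; first exact: wedge_nil.
by rewrite (wedge_cons _ _ _ a0) IHxs mul1r iprod_alt0 // wedge0l add0r.
Qed.

Definition munit : mform V := fun xs => (nilp xs)%:R.

(** Here [a] has no assigned degree, so masks are split directly: a mask that rejects the head feeds
    a nonempty list to [munit] and contributes 0. *)
Lemma wedge_munit a : wedge a munit = a.
Proof.
apply/funext => xs; elim: xs a => [|x xs IHxs] a.
  by rewrite wedge_nil mulr1.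
rewrite -[RHS]/(iprod x a xs) -(IHxs (iprod x a)) /wedge sum_tuple_cons.
rewrite big_split /= [X in _ + X]big1 => [|m _]; last first.
  by rewrite /munit /= !mulr0.
by rewrite addr0; apply: eq_bigr => m _; rewrite shuffle_sign_true.
Qed.

(** Induction on the total degree: by the Leibniz rule an interior product of [wedge a b] is a
    combination of wedges of total degree one less. *)
Lemma wedge_alt p q a b : alt p a -> alt q b -> alt (p + q) (wedge a b).
Proof.
move Er: (p + q)%N => r; elim: r p q Er a b => [|r IHr] p q.
  move=> /eqP; rewrite addn_eq0 => /andP[/eqP-> /eqP->] a b aP bP x xs.
  by rewrite wedge_scalar // bP mulr0.
move=> Er a b aP bP.
have IHl x : alt r (wedge (iprod x a) b).
  case: p aP Er => [aP _ | p aP [Er]].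
    by rewrite iprod_alt0 // wedge0l; apply: alt0.
  by apply: IHr Er _ _ _ bP; apply: iprod_alt.
have IHright x : alt r (wedge a (iprod x b)).
  case: q bP Er => [bP _ | q bP].
    by rewrite (iprod_alt0 _ bP) wedge0r; apply: alt0.
  by rewrite addnS => -[Er]; apply: IHr Er _ _ aP _; apply: iprod_alt.
split.
- rewrite wedge_nil; case: p q aP bP Er {IHl IHright} => [|p] [|q] //=.
  + by move=> _ [-> _ _ _]; rewrite mulr0.
  + by move=> [-> _ _ _]; rewrite mul0r.
  + by move=> [-> _ _ _]; rewrite mul0r.
- move=> c u v xs; rewrite !(wedge_cons _ _ _ aP).
  rewrite (iprod_lin _ _ _ aP) (iprod_lin _ _ _ bP).
  by rewrite wedge_linl wedge_linr; ring.
- move=> u xs; rewrite (wedge_cons _ _ _ aP).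
  case: p aP {IHl Er} => [aP | p aP].
    rewrite (iprod_alt0 _ aP) wedge0l add0r (wedge_cons _ _ _ aP).
    by rewrite (iprod_alt0 _ aP) (iprodxx _ bP) wedge0l wedge0r !mulr0 addr0 mulr0.
  (* Two uses of the Leibniz rule leave the cross term i_u a /\ i_u b twice, with opposite signs
     since [iprod u a] has degree one less than [a]. *)
  rewrite (wedge_cons _ _ _ (iprod_alt u aP)) (wedge_cons _ _ _ aP).
  by rewrite (iprodxx _ aP) (iprodxx _ bP) wedge0l wedge0r exprS; ring.
move=> u; have := alt_lin ((-1) ^+ p) (IHright u) (IHl u).
by congr alt; apply/funext => xs; rewrite addrC -(wedge_cons _ _ _ aP).
Qed.

(** * Expansion of forms in a frame *)

Section Frame.
Variables (n : nat) (e : n.-tuple V) (g : V -> V -> R).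
Hypothesis frameE : forall u, u = \sum_j g u (tnth e j) *: tnth e j.

Lemma alt_frame p a u xs : alt p.+1 a ->
  a (u :: xs) = \sum_j g u (tnth e j) * a (tnth e j :: xs).
Proof. by move=> aP; rewrite {1}(frameE u); apply: alt_suml aP. Qed.

(* Induction on the list of frame vectors v with iprod v a possibly nonzero:
   v itself kills iprod v a, so iprod v a = 0 with one vector less. *)
Lemma alt_gt_frame p a : alt p a -> (n < p)%N -> a = fun=> 0.
Proof.
rewrite -(size_tuple e) => aP.
have : forall j, tnth e j \in (e : seq V) \/ iprod (tnth e j) a = fun=> 0.
  by move=> j; left; apply: mem_tnth.
elim: (e : seq V) p a aP => [|v s IHs] [|p] a aP // ae lt_s_p.
  apply/funext => -[|u xs]; first by case: aP.
  rewrite (alt_frame _ _ aP) big1 // => j _.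
  by case: (ae j) => // /(congr1 (fun f => f xs)); rewrite /iprod => ->; rewrite mulr0.
have av : iprod v a = fun=> 0.
  apply: (IHs p) => //; first exact: iprod_alt.
  move=> j; have [->|ev] := eqVneq (tnth e j) v.
    by right; apply: iprodxx aP.
  case: (ae j); first by rewrite inE (negPf ev) => ?; left.
  move=> aj0; right; apply/funext => xs; rewrite /iprod (alt_swap _ _ _ aP).
  by rewrite -[a _]/(iprod (tnth e j) a (v :: xs)) aj0 oppr0.
apply: (IHs p.+1) => //; last exact: ltnW.
move=> j; case: (ae j); last by right.
by rewrite inE => /orP[/eqP-> | ?]; [right | left].
Qed.

(** Euler's identity, by induction on [p]. The Leibniz rule at the first argument x gives two sums:
    since i_x anticommutes with i_(e_j), one is minus the identity for i_x a; the other has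
    coefficients g(x, e_j) and is the frame expansion of [a] at x. *)
Lemma euler_wedge p a xs : alt p a ->
  \sum_j wedge (iprod (tnth e j) a) (form1 (g^~ (tnth e j))) xs
  = (-1) ^+ p.+1 * p%:R * a xs.
Proof.
elim: p a xs => [|p IHp] a xs aP.
  rewrite mulr0 mul0r big1 // => j _.
  by rewrite (iprod_alt0 _ aP) wedge0l.
case: xs => [|x xs].
  rewrite big1 => [|j _]; last by rewrite wedge_nil mulr0.
  by case: aP => ->; rewrite mulr0.
transitivity (\sum_j (- wedge (iprod (tnth e j) (iprod x a))
                          (form1 (g^~ (tnth e j))) xs
                      + (-1) ^+ p * (g x (tnth e j) * a (tnth e j :: xs)))).
  apply: eq_bigr => j _; rewrite (wedge_cons _ _ _ (iprod_alt _ aP)).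
  congr (_ + _ * _).
    rewrite -mulN1r -wedge_scalel; congr wedge; apply/funext => ys.
    by rewrite /iprod (alt_swap _ _ _ aP) mulN1r.
  (* The interior product of e_j^* with [x] is the constant g(x, e_j), that is, this scalar times
     [munit]. *)
  rewrite -[a _]/(iprod (tnth e j) a xs) -[iprod (tnth e j) a in RHS]wedge_munit.
  rewrite -wedge_scaler; congr wedge; apply/funext => -[|y ys].
    by rewrite /iprod /= mulr1.
  by rewrite /iprod /= mulr0.
rewrite big_split sumrN /= (IHp _ _ (iprod_alt x aP)) -mulr_sumr.
by rewrite -(alt_frame _ _ aP) /iprod !exprS -[in RHS]natr1; ring.
Qed.

End Frame.
End Forms.

Arguments munit {R V}.

(** * Products of double forms *)

Section DoubleForms.
Set Implicit Arguments.
Unset Strict Implicit.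

Variables (R : comNzRingType) (V : lmodType R).
Implicit Types (w : dform V) (xs ys : seq V) (c : R) (p q m : nat).

Definition dalt p q w : Prop :=
  (forall ys, alt p (w^~ ys)) /\ (forall xs, alt q (w xs)).

Definition iprodl x w : dform V := fun xs => w (x :: xs).
Definition iprodr y w : dform V := fun xs ys => w xs (y :: ys).

(** With the arguments on one side frozen, a product of double forms is a signed sum of wedges on
    the other side; this and its mirror image carry the results on forms over to double forms. *)
Lemma dmul_wedgel w1 w2 xs ys :
  dmul w1 w2 xs ys = \sum_(m : (size ys).-tuple bool)
    shuffle_sign R m *
    wedge (w1^~ (mask m ys)) (w2^~ (mask (map negb m) ys)) xs.
Proof.
rewrite /dmul exchange_big; apply: eq_bigr => m2 _ /=.
by rewrite /wedge mulr_sumr; apply: eq_bigr => m1 _; ring.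
Qed.

Lemma dmul_wedger w1 w2 xs ys :
  dmul w1 w2 xs ys = \sum_(m : (size xs).-tuple bool)
    shuffle_sign R m *
    wedge (w1 (mask m xs)) (w2 (mask (map negb m) xs)) ys.
Proof.
rewrite /dmul; apply: eq_bigr => m1 _ /=.
by rewrite /wedge mulr_sumr; apply: eq_bigr => m2 _; ring.
Qed.

Lemma dmul_dalt p1 q1 p2 q2 w1 w2 : dalt p1 q1 w1 -> dalt p2 q2 w2 ->
  dalt (p1 + p2) (q1 + q2) (dmul w1 w2).
Proof.
move=> [l1 r1] [l2 r2]; split=> zs.
  rewrite (funext (fun xs => dmul_wedgel w1 w2 xs zs)).
  by apply: alt_sum => m; apply/alt_scale/wedge_alt.
rewrite (funext (fun ys => dmul_wedger w1 w2 zs ys)).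
by apply: alt_sum => m; apply/alt_scale/wedge_alt.
Qed.

Lemma dunitE : @dunit R V = dtens munit munit.
Proof.
apply/funext => xs; apply/funext => ys.
by rewrite /dunit /dtens /munit; do 2!case: nilp; rewrite /= ?mulr1 ?mulr0.
Qed.

Lemma dexp_dalt p q w k : dalt p q w -> dalt (k * p) (k * q) (dexp w k).
Proof.
move=> wP; elim: k => [|k IHk]; last by rewrite !mulSn; apply: dmul_dalt.
by split=> zs x xs; rewrite /dexp /= dunitE /dtens /munit /= ?mul0r ?mulr0.
Qed.

Lemma dmul_consl p w1 w2 x xs ys : (forall zs, alt p (w1^~ zs)) ->
  dmul w1 w2 (x :: xs) ys
  = dmul (iprodl x w1) w2 xs ys + (-1) ^+ p * dmul w1 (iprodl x w2) xs ys.
Proof.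
move=> w1P; rewrite !dmul_wedgel mulr_sumr -big_split; apply: eq_bigr => m _.
by rewrite (wedge_cons _ _ _ (w1P _)) /=; ring.
Qed.

Lemma dmul_consr q w1 w2 xs y ys : (forall zs, alt q (w1 zs)) ->
  dmul w1 w2 xs (y :: ys)
  = dmul (iprodr y w1) w2 xs ys + (-1) ^+ q * dmul w1 (iprodr y w2) xs ys.
Proof.
move=> w1P; rewrite !dmul_wedger mulr_sumr -big_split; apply: eq_bigr => m _.
by rewrite (wedge_cons _ _ _ (w1P _)) /=; ring.
Qed.

Lemma dmul_dtensl w (a : mform V) xs ys :
  dmul w (dtens a munit) xs ys = wedge (w^~ ys) a xs.
Proof.
rewrite dmul_wedger [RHS]/wedge; apply: eq_bigr => m _; congr (_ * _).
by rewrite [LHS](wedge_scaler _ munit) wedge_munit mulrC.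
Qed.

Lemma dmul_dtensr w (b : mform V) xs ys :
  dmul w (dtens munit b) xs ys = wedge (w xs) b ys.
Proof.
rewrite dmul_wedgel [RHS]/wedge; apply: eq_bigr => m _; congr (_ * _).
transitivity (b (mask (map negb m) ys) * wedge (w^~ (mask m ys)) munit xs).
  by rewrite -wedge_scaler; congr (wedge _ _ _); apply/funext => zs; apply: mulrC.
by rewrite wedge_munit mulrC.
Qed.

Lemma dmulw1 w : dmul w (@dunit R V) = w.
Proof.
apply/funext => xs; apply/funext => ys.
by rewrite dunitE dmul_dtensl wedge_munit.
Qed.

Lemma dmul_scalel c w1 w2 : dmul (c *: w1) w2 = c *: dmul w1 w2.
Proof.
apply/funext => xs; apply/funext => ys.
rewrite -[RHS]/(c * dmul w1 w2 xs ys) /dmul mulr_sumr; apply: eq_bigr => m1 _.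
rewrite mulr_sumr; apply: eq_bigr => m2 _.
by rewrite -[(c *: w1) _ _]/(c * w1 _ _); ring.
Qed.

Lemma dmul_suml n (F : 'I_n -> dform V) w xs ys :
  dmul (fun xs ys => \sum_j F j xs ys) w xs ys = \sum_j dmul (F j) w xs ys.
Proof.
rewrite /dmul [RHS]exchange_big; apply: eq_bigr => m1 _ /=.
rewrite [RHS]exchange_big; apply: eq_bigr => m2 _ /=.
by rewrite mulr_suml mulr_sumr.
Qed.

Lemma dmul_scalar s w : dalt 0 0 s -> dmul s w = s [::] [::] *: w.
Proof.
case=> ls rs; apply/funext => xs; apply/funext => ys.
rewrite -[RHS]/(s [::] [::] * w xs ys) -(wedge_scalar (w xs) ys (rs [::])).
rewrite dmul_wedgel [RHS]/wedge; apply: eq_bigr => m _; congr (_ * _).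
exact: wedge_scalar.
Qed.

(** * Contraction of products with the metric *)

Section Metric.
Variables (n : nat) (e : n.-tuple V) (g : V -> V -> R).
Hypothesis g_lin : forall c u v x, g (c *: u + v) x = c * g u x + g v x.
Hypothesis gC : forall x y, g x y = g y x.
Hypothesis g_norm : forall j, g (tnth e j) (tnth e j) = 1.
Hypothesis frameE : forall u, u = \sum_j g u (tnth e j) *: tnth e j.
Let G := dform11 g.

Lemma dform11_dalt : dalt 1 1 G.
Proof.
rewrite /G /dform11; split=> [ys|xs]; split=> //.
- by move=> c u v [|x xs]; case: ys => [|y [|? ?]]; rewrite ?mulr0 ?addr0 //.
- by case: xs => [|? []].
- move=> c u v ys; case: xs => [|x [|? ?]]; rewrite ?mulr0 ?addr0 //.
  by case: ys => [|? ?]; rewrite ?mulr0 ?addr0 // ![g x _]gC g_lin.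
- by move=> u ys; case: xs => [|? []].
- by move=> u y ys; rewrite /iprod; case: xs => [|? []].
Qed.

Lemma contr_dalt p q w : dalt p.+1 q.+1 w -> dalt p q (contr e w).
Proof.
move=> [lw rw]; split=> zs.
  apply: (@alt_sum _ _ p _ _ (fun j => iprod (tnth e j) (w^~ (tnth e j :: zs)))) => j.
  exact: iprod_alt.
apply: (@alt_sum _ _ q _ _ (fun j => iprod (tnth e j) (w (tnth e j :: zs)))) => j.
exact: iprod_alt.
Qed.

Lemma contrn_dalt p q m w :
  dalt (m + p) (m + q) w -> dalt p q (contrn e m w).
Proof.
elim: m p q => [|m IHm] p q //=.
by rewrite !addSnnS => /IHm; apply: contr_dalt.
Qed.

Lemma dalt_gt_dim p q w : dalt p q w -> (n < p)%N -> w = 0.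
Proof.
move=> [lw _] ltnp; apply/funext => xs; apply/funext => ys.
by rewrite -[w xs ys]/(w^~ ys xs) (alt_gt_frame frameE (lw ys) ltnp).
Qed.

(** The Leibniz rule on both sides yields four sums over j. Both interior products on [w] give (c w)
    g; one on each factor turns g into e_j^*, and Euler's identity gives -p w, twice; both on g give
    g(e_j, e_j) = 1, hence n w. *)
Lemma contr_dmul_metric p w : dalt p p w ->
  contr e (dmul w G) = dmul (contr e w) G + (n%:R - (2 * p)%:R) *: w.
Proof.
move=> [lw rw]; apply/funext => xs; apply/funext => ys.
rewrite -[RHS]/(dmul (contr e w) G xs ys + (n%:R - (2 * p)%:R) * w xs ys).
rewrite (dmul_suml (fun j => iprodl (tnth e j) (iprodr (tnth e j) w))).
have Gr x : iprodr x G = dtens (form1 (g^~ x)) munit.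
  apply/funext => zs; apply/funext => ts; rewrite /iprodr /G /dtens /munit.
  by case: zs ts => [|z [|? ?]] [|? ?]; rewrite /= ?mul0r ?mulr0 ?mulr1.
have Gl x : iprodl x G = dtens munit (form1 (g^~ x)).
  apply/funext => zs; apply/funext => ts; rewrite /iprodl /G /dtens /munit.
  by case: zs ts => [|? ?] [|t [|? ?]]; rewrite /= ?mul0r ?mulr0 ?mul1r // gC.
have Grl j : iprodr (tnth e j) (iprodl (tnth e j) G) = @dunit R V.
  rewrite Gl dunitE; apply/funext => zs; apply/funext => ts.
  rewrite /iprodr /dtens /=; congr (_ * _).
  by case: ts => //=; rewrite g_norm.
transitivity (\sum_j
   (dmul (iprodl (tnth e j) (iprodr (tnth e j) w)) G xs ys
    + (-1) ^+ p * wedge (iprod (tnth e j) (w^~ ys)) (form1 (g^~ (tnth e j))) xs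
    + (-1) ^+ p * wedge (iprod (tnth e j) (w xs)) (form1 (g^~ (tnth e j))) ys
    + w xs ys)).
  apply: eq_bigr => j _; rewrite (dmul_consl _ _ _ _ lw).
  rewrite (@dmul_consr p) => [|zs]; last exact: rw.
  rewrite (@dmul_consr p) // Grl dmulw1 Gr Gl dmul_dtensl dmul_dtensr.
  have sign2 : (-1) ^+ p * (-1) ^+ p = 1 :> R by rewrite -expr2 sqrr_sign.
  by rewrite mulrDr (mulrA ((-1) ^+ p)) sign2 mul1r !addrA.
rewrite !big_split /= sumr_const card_ord -!mulr_sumr.
rewrite (euler_wedge frameE _ (lw ys)) (euler_wedge frameE _ (rw xs)).
have sign2 : (-1) ^+ p * (-1) ^+ p.+1 = -1 :> R.
  by rewrite exprS mulrCA -expr2 sqrr_sign mulr1.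
by rewrite !mulrA sign2 natrM -mulr_natl; ring.
Qed.

Lemma contr_lin c w1 w2 : contr e (w1 + c *: w2) = contr e w1 + c *: contr e w2.
Proof.
apply/funext => xs; apply/funext => ys.
rewrite -[RHS]/(contr e w1 xs ys + c * contr e w2 xs ys) /contr mulr_sumr.
by rewrite -big_split.
Qed.

(** Since c^i w has bidegree (p-i, p-i), the coefficient is the sum of n - 2p + 2i over i from 0 to
    m. *)
Lemma contrn_dmul_metric p m w : dalt p p w -> (m <= p)%N ->
  contrn e m.+1 (dmul w G) = dmul (contrn e m.+1 w) G
    + (m.+1%:R * (n%:R - (2 * p)%:R + m%:R)) *: contrn e m w.
Proof.
move=> wP; elim: m => [_|m IHm ltmp].
  by rewrite mul1r addr0; apply: contr_dmul_metric.
rewrite [LHS]/= [contr _ (contrn _ _ _)]IHm; last exact: ltnW.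
(* The bound on [m] keeps this natural subtraction from truncating. *)
rewrite contr_lin (@contr_dmul_metric (p - m.+1)); last first.
  by apply: contrn_dalt; rewrite subnKC.
rewrite -addrA -scalerDl; congr (_ + _ *: _).
rewrite natrM natrB // natrM -!natr1; ring.
Qed.

End Metric.
End DoubleForms.

(** * Orthonormal bases and the final computation *)

Lemma orthonormal_nth (R : realType) (V : vectType R) (g : {dot V for idfun})
    (s : seq V) (i j : nat) :
  orthonormal g s -> (i < size s)%N -> (j < size s)%N ->
  g s`_i s`_j = (i == j)%:R.
Proof.
case/andP=> /allP norm_s.
have gC x y : g x y = g y x by rewrite hermC expr0 mul1r.
(* [orthonormal] compares each vector only with the later ones; symmetry of [g] covers the other
   order. *)
wlog le_ij : i j / (i <= j)%N => [IH os lt_i lt_j | ].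
  by case: (leqP i j) => [/IH | /ltnW/IH]; [| rewrite gC eq_sym]; apply.
move=> os lt_i lt_j.
have [->|neq_ij] := eqVneq i j; first by apply/eqP/norm_s/mem_nth.
have {neq_ij le_ij} : (i < j)%N by rewrite ltn_neqAle neq_ij.
elim: s i j os lt_i lt_j {norm_s} => // x s IHs [|i] [|j] //= /andP[].
  by rewrite /ortho_rec /= andbT => /allP xs _ _ lt_j _; apply/eqP/xs/mem_nth.
by move=> _ /IHs; apply.
Qed.

Theorem theorem3p6 (R : realType) (V : vectType R) (g : {dot V for idfun})
    (n k : nat) (hn : n = (2 * k + 1)%N) (hn3 : (3 <= n)%N)
    (hV : \dim {:V} = n)
    (e : n.-tuple V) (he : orthonormal_basis g e)
    (Rm : dform V) (hRm : is_double_form 2 2 Rm)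
    (hsym : dsymmetric Rm) (hB : bianchi1 Rm) :
  let G : dform V := dform11 g in
  let Rk : dform V := dexp Rm k in
  ((n - 3)`!%:R : R)^-1 *: contrn e (n - 3) Rk
  - dmul (((n - 2)`!%:R : R)^-1 *: contrn e (n - 2) Rk) G
  + dmul ((2 * (n - 1)`!%:R : R)^-1 *: contrn e (n - 1) Rk) (dexp G 2)
  = 0 :> dform V.
Proof.
move=> G Rk; case: he => basis_e on_e.
have g_lin c u v x : g (c *: u + v) x = c * g u x + g v x.
  by rewrite linearPl.
have gC x y : g x y = g y x by rewrite hermC expr0 mul1r.
have ge i j : g (tnth e i) (tnth e j) = (i == j)%:R.
  by rewrite !(tnth_nth 0) (orthonormal_nth on_e) ?size_tuple.
have g_norm j : g (tnth e j) (tnth e j) = 1 by rewrite ge eqxx.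
have frameE u : u = \sum_j g u (tnth e j) *: tnth e j.
  have u_e : u = \sum_j coord e j u *: tnth e j.
    rewrite {1}(coord_basis basis_e (memvf u)); apply: eq_bigr => j _.
    by rewrite (tnth_nth 0).
  (* Pairing the basis expansion of [u] with e_j identifies its j-th coordinate with g(u, e_j). *)
  rewrite {1}u_e; apply: eq_bigr => j _; congr (_ *: _).
  rewrite [in RHS]u_e linear_sumlz (bigD1 j) //= big1 => [|i neq_ij].
    by rewrite linearZl_LR /= ge eqxx mulr1 addr0.
  by rewrite linearZl_LR /= ge (negPf neq_ij) mulr0.
(* With n = p + 3, the truncated differences n-3, n-2, n-1 become p, p+1, p+2, and the degree 2k of
   R^k is p+2. *)
have [p Ep] : exists p, n = p.+3 by exists (n - 3)%N; rewrite -{1}(subnKC hn3).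
have RkP : dalt p.+2 p.+2 Rk.
  have -> : p.+2 = (k * 2)%N by apply/eqP; rewrite -eqSS -Ep hn addn1 mulnC.
  apply: dexp_dalt; case: hRm => lRm rRm.
  by split=> zs; apply: is_form_alt; [apply: lRm | apply: rRm].
have GP := dform11_dalt g_lin gC.
have GRkP : dalt p.+3 p.+3 (dmul Rk G) by rewrite -(addn1 p.+2); apply: dmul_dalt.
have GGRk0 : dmul (dmul Rk G) G = 0.
  apply: (dalt_gt_dim frameE (p := p.+4) (q := p.+4)); last by rewrite Ep.
  by rewrite -(addn1 p.+3); apply: dmul_dalt.
have cG := contrn_dmul_metric gC g_norm frameE.
(* The correction term vanishes: its factor is n - 2(p+2) + (p+1) = 0. *)
have c2RkG : contrn e p.+2 (dmul Rk G) = dmul (contrn e p.+2 Rk) G.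
  rewrite (cG _ p.+1 _ RkP) // [X in X *: _](_ : _ = 0) ?scale0r ?addr0 //.
  by rewrite {1}Ep natrM -!natr1; ring.
(* One contraction fewer makes that factor n - 2(p+2) + p = -1. *)
have c1RkG : contrn e p.+1 (dmul Rk G)
             = dmul (contrn e p.+1 Rk) G - p.+1%:R *: contrn e p Rk.
  rewrite (cG _ p _ RkP); last exact: leqW (leqW _).
  rewrite -scaleNr; congr (_ + _ *: _).
  by rewrite {1}Ep natrM -!natr1; ring.
have key : dmul (dmul (contrn e p.+2 Rk) G) G
           - (2 * p.+2%:R) *: (dmul (contrn e p.+1 Rk) G
                               - p.+1%:R *: contrn e p Rk) = 0.
  rewrite -c2RkG -c1RkG -scaleNr.
  (* This is the coefficient of the contraction formula for w = R^k g, of bidegree (p+3, p+3), so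
     the left side becomes c^(p+2) of the zero form (R^k g) g. *)
  have -> : - (2 * p.+2%:R) = p.+2%:R * (n%:R - (2 * p.+3)%:R + p.+1%:R) :> R.
    by rewrite Ep natrM -!natr1; ring.
  rewrite -(cG _ p.+1 _ GRkP (leqW (leqnSn _))) GGRk0.
  apply/funext => xs; apply/funext => ys; elim: (p.+2) xs ys => [|m IHm] xs ys //.
  by rewrite /= /contr big1 // => j _; apply: IHm.
have -> : dexp G 2 = dmul G G by rewrite /dexp /= dmulw1.
have c2P : dalt 0 0 (contrn e p.+2 Rk) by apply: contrn_dalt; rewrite addn0.
have [-> -> ->] : [/\ n - 3 = p, n - 2 = p.+1 & n - 1 = p.+2]%N.
  by rewrite Ep !subSS !subn0.
have f0 : p`!%:R != 0 :> R by rewrite pnatr_eq0 -lt0n fact_gt0.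
have p1 : 1 + p%:R != 0 :> R by rewrite nat1r pnatr_eq0.
have p2 : 1 + (1 + p%:R) != 0 :> R by rewrite !nat1r pnatr_eq0.
rewrite !dmul_scalel (dmul_scalar _ c2P).
move: key; rewrite (dmul_scalar _ c2P) dmul_scalel.
set D := contrn e p Rk; set X := dmul (contrn _ _ _) G; set Y := _ *: dmul G G => key.
(* The claim is [key] divided by 2 (n-1)!, using (p+2)! = (p+2)(p+1) p!. *)
have -> : p`!%:R^-1 *: D - p.+1`!%:R^-1 *: X + (2 * p.+2`!%:R)^-1 *: Y
          = (2 * p.+2`!%:R : R)^-1 *: (Y - (2 * p.+2%:R) *: (X - p.+1%:R *: D)).
  rewrite !scalerBr !scalerA opprB [RHS]addrC; congr (_ *: _ - _ *: _ + _).
    by rewrite !factS !natrM -!nat1r; field; rewrite f0 p1 p2.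
  by rewrite !factS !natrM -!nat1r; field; rewrite f0 p1 p2.
by rewrite key scaler0.
Qed.
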